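(* Let $f\in\mathbb{Z}[\mathbb{H}]$ be of the form $f=g_1(y,z)x-g_0(y,z)$ with $g_0,g_1\in\mathbb{Z}[y,z]\simeq\mathbb{Z}[\mathbb{Z}^2]$. Suppose there exists an element $\chi\in\mathbb{S}$ of infinite order such that $$\mathsf{U}_\chi(g_0)\neq\varnothing,\qquad \mathsf{U}_\chi(g_1)\neq\varnothing\qquad\text{and}\qquad \mathfrak{m}(g_{0,\chi})\neq\mathfrak{m}(g_{1,\chi}).$$ Then the principal algebraic action $\alpha_f$ on $X_f$ is non-expansive (i.e. not expansive).
   Context: $\mathbb{S}=\{\zeta\in\mathbb{C}:|\zeta|=1\}$. $\mathbb{H}$ is the discrete Heisenberg group of upper triangular unipotent $3\times3$ integer matrices, generated by $x=\begin{pmatrix}1&1&0\\0&1&0\\0&0&1\end{pmatrix}$, $y=\begin{pmatrix}1&0&0\\0&1&1\\0&0&1\end{pmatrix}$, with central element $z=xyx^{-1}y^{-1}$. $\mathbb{Z}[\mathbb{H}]$ is the integer group ring; $\mathbb{Z}[y,z]\simeq\mathbb{Z}[\mathbb{Z}^2]$ means integer Laurent polynomials in the commuting elements $y,z$. For $\chi\in\mathbb{S}$ and $i=0,1$: $\mathsf{U}_\chi(g_i)=\{\zeta\in\mathbb{S}:g_i(\zeta,\chi)=0\}$, and $g_{i,\chi}(y)=g_i(y,\chi)$, viewed as a complex Laurent polynomial in $y$. For a complex Laurent polynomial $h$ in one variable, $\mathfrak{m}(h)=\int_{\mathbb{T}}\log|h(e^{2\pi i t})|\,dt$ is the logarithmic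 Mahler measure (equal to $-\infty$ if $h=0$), where $\mathbb{T}=\mathbb{R}/\mathbb{Z}$. For $f=\sum_\gamma f_\gamma\cdot\gamma\in\mathbb{Z}[\mathbb{H}]$, $X_f=\{v\in\mathbb{T}^{\mathbb{H}}:\sum_{\gamma\in\mathbb{H}}f_\gamma v_{\gamma'\gamma}=0\text{ for every }\gamma'\in\mathbb{H}\}$ and $\alpha_f$ is the restriction to $X_f$ of the left shift action $(\lambda^\gamma v)_{\gamma'}=v_{\gamma^{-1}\gamma'}$. An action $\alpha$ of a countable group $\Gamma$ by automorphisms of a compact metrisable abelian group $X$, with translation invariant (compatible) metric $d$, is expansive if there is $\varepsilon>0$ with $\sup_{\gamma\in\Gamma}d(\alpha^\gamma v,\alpha^\gamma w)>\varepsilon$ for all distinct $v,w\in X$. *)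

(* Defs.v *)
From HB Require Import structures.
From mathcomp Require Import all_boot all_order all_algebra.
From mathcomp Require Import finmap.
From mathcomp Require Import all_classical all_reals all_analysis.
From mathcomp Require Import complex.
From mathcomp Require Import -(notations) monalg.

Set Implicit Arguments.
Unset Strict Implicit.
Unset Printing Implicit Defensive.

Import Order.TTheory GRing.Theory Num.Theory.
Import numFieldNormedType.Exports.

Local Open Scope classical_set_scope.
Local Open Scope ring_scope.

Notation "<< c *g k >>" := (mkmalgU k c) (at level 0, format "<< c *g k >>").

Section Heisenberg.

Definition unipotent_upper (A : 'M[int]_3) : bool :=
  [forall i : 'I_3, forall j : 'I_3, (j <= i)%N ==> (A i j == (i == j)%:R)].

Record heisenberg : predArgType :=
  Heisenberg { heis_mx :> 'M[int]_3; _ : unipotent_upper heis_mx }.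

HB.instance Definition _ := [isSub for heis_mx].
HB.instance Definition _ := [Choice of heisenberg by <:].

Lemma unipotent_upperP (A : 'M[int]_3) :
  reflect (forall i j : 'I_3, (j <= i)%N -> A i j = (i == j)%:R)
          (unipotent_upper A).
Proof.
apply: (iffP 'forall_forallP) => h i j; first by move=> ij; exact/eqP/(implyP (h i j)).
by apply/implyP => ij; apply/eqP/h.
Qed.

Lemma unipotent_upper1 : unipotent_upper 1%:M.
Proof. by apply/unipotent_upperP => i j _; rewrite mxE. Qed.

Lemma unipotent_upperM (A B : 'M[int]_3) :
  unipotent_upper A -> unipotent_upper B -> unipotent_upper (A *m B).
Proof.
move=> /unipotent_upperP hA /unipotent_upperP hB.
apply/unipotent_upperP => i j ji; rewrite mxE (bigD1 i) //= hA // eqxx mul1r.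
rewrite hB // big1 ?addr0 // => k ki.
have [ik|ik] := leqP k i; first by rewrite hA // eq_sym (negPf ki) mul0r.
rewrite hB ?(leq_trans ji (ltnW ik)) //.
have -> : (k == j) = false by rewrite -val_eqE /= gtn_eqF // (leq_ltn_trans ji).
by rewrite mulr0.
Qed.

(* (1 + N)^-1 = 1 - N + N^2, because N^3 = 0. *)
Definition unipotent_inv (A : 'M[int]_3) : 'M[int]_3 :=
  let N := A - 1%:M in 1%:M - N + N *m N.

Lemma unipotent_nil (A : 'M[int]_3) : unipotent_upper A ->
  let N := A - 1%:M in N *m N *m N = 0.
Proof.
move=> /unipotent_upperP hA N.
have hN (i j : 'I_3) : (j <= i)%N -> N i j = 0.
  by move=> ji; rewrite !mxE hA // subrr.
apply/matrixP => i j; rewrite mxE big1 ?mxE // => k _.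
have [jk|kj] := leqP j k; first by rewrite (hN k j) ?mulr0.
rewrite mxE big1 ?mul0r // => l _.
have [li|il] := leqP l i; first by rewrite (hN i l) ?mul0r.
have [kl|lk] := leqP k l; first by rewrite (hN l k) ?mulr0.
have := ltn_ord j; rewrite ltnNge; case/negP.
by rewrite (leq_trans _ kj) // ltnS (leq_trans _ lk) // ltnS (leq_ltn_trans _ il).
Qed.

Lemma unipotent_upperV (A : 'M[int]_3) :
  unipotent_upper A -> unipotent_upper (unipotent_inv A).
Proof.
move=> /unipotent_upperP hA; apply/unipotent_upperP => i j ji.
have hN (k l : 'I_3) : (l <= k)%N -> (A - 1%:M) k l = 0.
  by move=> lk; rewrite !mxE hA // subrr.
rewrite /unipotent_inv; move: (A - 1%:M) hN => N hN.
rewrite mxE [X in _ + X]mxE big1 ?addr0 => [|k _].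
  by rewrite !mxE hN // subr0.
have [ki|ik] := leqP k i; first by rewrite (hN i k) ?mul0r.
by rewrite (hN k j) ?mulr0 // (leq_trans ji (ltnW ik)).
Qed.

Lemma unipotent_mulV (A : 'M[int]_3) :
  unipotent_upper A -> A *m unipotent_inv A = 1%:M.
Proof.
move=> /unipotent_nil; rewrite /unipotent_inv /=; set N := A - 1%:M => N3.
have -> : A = 1%:M + N by rewrite addrC subrK.
clearbody N; rewrite mulmxDl mul1mx mulmxDr mulmxBr mulmx1 mulmxA N3 addr0.
by rewrite addrACA subrK subrr addr0.
Qed.

Lemma unipotent_Vmul (A : 'M[int]_3) :
  unipotent_upper A -> unipotent_inv A *m A = 1%:M.
Proof. by move=> /unipotent_mulV /mulmx1C. Qed.

Definition heis_one : heisenberg := Heisenberg unipotent_upper1.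
Definition heis_mul (a b : heisenberg) : heisenberg :=
  Heisenberg (unipotent_upperM (valP a) (valP b)).
Definition heis_inv (a : heisenberg) : heisenberg :=
  Heisenberg (unipotent_upperV (valP a)).

Lemma heis_mulA : associative heis_mul.
Proof. by move=> a b c; apply: val_inj; rewrite /= mulmxA. Qed.
Lemma heis_mul1 : left_id heis_one heis_mul.
Proof. by move=> a; apply: val_inj; rewrite /= mul1mx. Qed.
Lemma heis_mulr1 : right_id heis_one heis_mul.
Proof. by move=> a; apply: val_inj; rewrite /= mulmx1. Qed.
Lemma heis_mulV : left_inverse heis_one heis_inv heis_mul.
Proof. by move=> a; apply: val_inj; rewrite /= unipotent_Vmul //; exact: valP. Qed.
Lemma heis_mulrV : right_inverse heis_one heis_inv heis_mul.
Proof. by move=> a; apply: val_inj; rewrite /= unipotent_mulV //; exact: valP. Qed.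

HB.instance Definition _ :=
  isGroup.Build heisenberg heis_mulA heis_mul1 heis_mulr1 heis_mulV heis_mulrV.

Lemma unipotent_elem (i j : 'I_3) :
  (i < j)%N -> unipotent_upper (1%:M + delta_mx i j).
Proof.
move=> ij; apply/unipotent_upperP => k l lk; rewrite !mxE.
suff -> : (k == i) && (l == j) = false by rewrite addr0.
apply/negbTE/negP => /andP[/eqP ki /eqP lj].
by move: lk; rewrite ki lj leqNgt ij.
Qed.

Definition hx : heisenberg :=
  Heisenberg (@unipotent_elem (inord 0) (inord 1) ltac:(by rewrite !inordK)).
Definition hy : heisenberg :=
  Heisenberg (@unipotent_elem (inord 1) (inord 2) ltac:(by rewrite !inordK)).
Definition hz : heisenberg := (hx * hy * hx^-1 * hy^-1)%g.

End Heisenberg.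

(* [malg G int] only has a ring structure when [G] is a [monomType], which
   excludes nontrivial groups; this alias carries the convolution product. *)
Definition group_ring (G : groupType) : Type := (malg G int).

Section GroupRing.
Variable G : groupType.
Implicit Types (f g h : group_ring G) (a b : G).

HB.instance Definition _ := GRing.Zmodule.copy (group_ring G) (malg G int).

Definition gr_elt a : group_ring G := << 1 *g a >>.

Definition gr_mul f g : group_ring G :=
  \sum_(a <- msupp f) \sum_(b <- msupp g) << mcoeff a f * mcoeff b g *g (a * b)%g >>.

Lemma gr_mulw (d1 d2 : {fset G}) f g :
  (msupp f `<=` d1)%fset -> (msupp g `<=` d2)%fset ->
  gr_mul f g =
  \sum_(a <- d1) \sum_(b <- d2) << mcoeff a f * mcoeff b g *g (a * b)%g >>.
Proof.
move=> le1 le2; rewrite /gr_mul (big_fset_incl _ le1) /=.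
  apply: eq_bigr => a _; apply: big_fset_incl => // b _ /mcoeff_outdom ->.
  by rewrite mulr0 monalgU0.
move=> a _ /mcoeff_outdom fa; rewrite big1 // => b _.
by rewrite fa mul0r monalgU0.
Qed.

Lemma gr_mul0 : left_zero 0 gr_mul.
Proof. by move=> g; rewrite /gr_mul msupp0 big_seq_fset0. Qed.

Lemma gr_mulr0 : right_zero 0 gr_mul.
Proof.
by move=> g; rewrite /gr_mul big1 // => a _; rewrite msupp0 big_seq_fset0.
Qed.

Lemma gr_mulUU (m n : int) a b :
  gr_mul << m *g a >> << n *g b >> = << m * n *g (a * b)%g >>.
Proof.
by rewrite (gr_mulw msuppU_le msuppU_le) !big_seq_fset1 !mcoeffUU.
Qed.

Lemma gr_mulDl : left_distributive gr_mul +%R.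
Proof.
move=> f1 f2 g.
rewrite [gr_mul f1 g](gr_mulw (fsubsetUl _ (msupp f2)) (fsubset_refl _)).
rewrite [gr_mul f2 g](gr_mulw (fsubsetUr (msupp f1) _) (fsubset_refl _)).
rewrite (gr_mulw (msuppD_le _ _) (fsubset_refl _)).
rewrite -big_split /=; apply: eq_bigr => a _.
rewrite -big_split /=; apply: eq_bigr => b _.
by rewrite mcoeffD mulrDl monalgUD.
Qed.

Lemma gr_mulDr : right_distributive gr_mul +%R.
Proof.
move=> f g1 g2.
rewrite [gr_mul f g1](gr_mulw (fsubset_refl _) (fsubsetUl _ (msupp g2))).
rewrite [gr_mul f g2](gr_mulw (fsubset_refl _) (fsubsetUr (msupp g1) _)).
rewrite (gr_mulw (fsubset_refl _) (msuppD_le _ _)).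
rewrite -big_split /=; apply: eq_bigr => a _.
rewrite -big_split /=; apply: eq_bigr => b _.
by rewrite mcoeffD mulrDr monalgUD.
Qed.

Let mulsl (I : Type) (r : seq I) (F : I -> group_ring G) g :
  gr_mul (\sum_(i <- r) F i) g = \sum_(i <- r) gr_mul (F i) g.
Proof. exact: (big_morph (gr_mul^~ g) (fun _ _ => gr_mulDl _ _ _) (gr_mul0 g)). Qed.

Let mulsr (I : Type) (r : seq I) (F : I -> group_ring G) g :
  gr_mul g (\sum_(i <- r) F i) = \sum_(i <- r) gr_mul g (F i).
Proof. exact: (big_morph (gr_mul g) (fun _ _ => gr_mulDr _ _ _) (gr_mulr0 g)). Qed.

Let mulEl f g : gr_mul f g = \sum_(a <- msupp f) gr_mul << mcoeff a f *g a >> g.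
Proof. by rewrite -mulsl; congr gr_mul; exact: monalgE. Qed.

Let mulEr f g : gr_mul f g = \sum_(b <- msupp g) gr_mul f << mcoeff b g *g b >>.
Proof. by rewrite -mulsr; congr gr_mul; exact: monalgE. Qed.

Lemma gr_mulA : associative gr_mul.
Proof.
move=> f g h.
rewrite (mulEl f (gr_mul g h)) (mulEl f g) mulsl; apply: eq_bigr => a _.
rewrite (mulEl g h) mulsr (mulEr _ g) mulsl; apply: eq_bigr => b _.
rewrite (mulEr _ h) mulsr (mulEr _ h); apply: eq_bigr => c _.
by rewrite !gr_mulUU mulrA mulgA.
Qed.

Lemma gr_mul1 : left_id (gr_elt 1%g) gr_mul.
Proof.
move=> f; rewrite mulEr [RHS]monalgE; apply: eq_bigr => a _.
by rewrite gr_mulUU mul1r mul1g.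
Qed.

Lemma gr_mulr1 : right_id (gr_elt 1%g) gr_mul.
Proof.
move=> f; rewrite mulEl [RHS]monalgE; apply: eq_bigr => a _.
by rewrite gr_mulUU mulr1 mulg1.
Qed.

Lemma gr_one_neq0 : gr_elt 1%g != 0.
Proof.
by rewrite /gr_elt; apply/eqP => /(congr1 (mcoeff 1%g)) /eqP; rewrite mcoeffUU mcoeff0.
Qed.

HB.instance Definition _ := GRing.Zmodule_isNzRing.Build (group_ring G)
  gr_mulA gr_mul1 gr_mulr1 gr_mulDl gr_mulDr gr_one_neq0.

End GroupRing.

Section Laurent.

(* Laurent polynomials, given by their finitely supported coefficients:
   [mcoeff (m, n) g] is the coefficient of y^m z^n. *)
Definition laurent2 := malg (int * int)%type int.
Definition laurent1 (K : zmodType) := malg int K.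

Definition expgz (G : groupType) (a : G) (m : int) : G :=
  match m with Posz k => (a ^+ k)%g | Negz k => (a ^- k.+1)%g end.

Definition laurent_yz (g : laurent2) : group_ring heisenberg :=
  \sum_(k <- msupp g) << mcoeff k g *g (expgz hy k.1 * expgz hz k.2)%g >>.

Definition laurent2_eval (K : unitRingType) (g : laurent2) (a b : K) : K :=
  \sum_(k <- msupp g) (mcoeff k g)%:~R * (a ^ k.1 * b ^ k.2).

Definition laurent1_eval (K : unitRingType) (h : laurent1 K) (a : K) : K :=
  \sum_(m <- msupp h) mcoeff m h * a ^ m.

(* g(y, b) as a Laurent polynomial in y. *)
Definition laurent_specialize (K : unitRingType) (g : laurent2) (b : K) :
    laurent1 K :=
  \sum_(k <- msupp g) << (mcoeff k g)%:~R * b ^ k.2 *g k.1 >>.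

End Laurent.

Section Complex.
Variable R : realType.

Definition unit_circle : set R[i] := [set zeta | `|zeta| = 1].

Definition U_ (chi : R[i]) (g : laurent2) : set R[i] :=
  [set zeta | unit_circle zeta /\ laurent2_eval g zeta chi = 0].

(* The integral over R/Z is computed on the fundamental domain [0, 1];
   [lne 0 = -oo]. *)
Definition log_mahler (h : laurent1 R[i]) : \bar R :=
  \int[@lebesgue_measure R]_(t in `[0%R, 1%R])
    lne (Normc.normc
           (laurent1_eval h (Complex (cos (2 * pi * t)) (sin (2 * pi * t)))))%:E.

End Complex.

Section Torus.
Variable R : realType.

Definition integers : R -> bool := fun x => x \is a Num.int.

Lemma integers_zmod_closed : zmod_closed integers.
Proof. by split=> [|x y]; [exact: rpred0|exact: rpredB]. Qed.
HB.instance Definition _ := GRing.isZmodClosed.Build R integers integers_zmod_closed.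

Definition integers_closed : zmodClosed R :=
  GRing.ZmodClosed.clone R integers _.

Definition torus : Type := Quotient.quot integers_closed.
HB.instance Definition _ := EqQuotient.on torus.
HB.instance Definition _ := GRing.Zmodule.on torus.

(* The quotient topology, restated because the library's [quotient_topology]
   comes with a choice structure that does not unify with that of [torus] as a
   Z-module. *)
Definition torus_open (A : set torus) : Prop := open (\pi_torus%qT @^-1` A).

Lemma torus_openT : torus_open setT.
Proof. by rewrite /torus_open preimage_setT; exact: openT. Qed.

Lemma torus_openI (A B : set torus) :
  torus_open A -> torus_open B -> torus_open (A `&` B).
Proof. exact: openI. Qed.

Lemma torus_open_bigcup (I : Type) (F : I -> set torus) :
  (forall i, torus_open (F i)) -> torus_open (\bigcup_i F i).
Proof. by move=> oF; apply: bigcup_open => i _; exact: oF. Qed.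

HB.instance Definition _ :=
  isOpenTopological.Build torus torus_openT torus_openI torus_open_bigcup.

End Torus.

Section Shift.
Variables (R : realType) (G : groupType).

Definition shift_space : Type := {ptws G -> torus R}.
HB.instance Definition _ := Topological.copy shift_space
  (prod_topology (fun _ : G => torus R : topologicalType)).
HB.instance Definition _ := GRing.Zmodule.copy shift_space (G -> torus R).

Definition left_shift (a : G) (v : shift_space) : shift_space :=
  fun b => v (a^-1 * b)%g.

Definition principal_set (f : group_ring G) : set shift_space :=
  [set v | forall b : G, \sum_(a <- msupp f) v (b * a)%g *~ mcoeff a f = 0].

Lemma principal_set0 f : principal_set f 0.
Proof. by move=> b; rewrite big1 // => a _; rewrite mul0rz. Qed.

Lemma principal_setD f v w :
  principal_set f v -> principal_set f w -> principal_set f (v + w).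
Proof.
move=> hv hw b; have := congr2 +%R (hv b) (hw b).
rewrite addr0 -big_split /= => E; rewrite -[RHS]E; apply: eq_bigr => a _.
by rewrite -mulrzDl.
Qed.

Lemma principal_setN f v : principal_set f v -> principal_set f (- v).
Proof.
move=> hv b; have := congr1 -%R (hv b).
rewrite oppr0 -sumrN => E; rewrite -[RHS]E; apply: eq_bigr => a _.
by rewrite -mulNrz.
Qed.

Lemma principal_set_shift f a v :
  principal_set f v -> principal_set f (left_shift a v).
Proof.
move=> hv b; rewrite -[RHS](hv (a^-1 * b)%g).
by apply: eq_bigr => c _; rewrite /left_shift mulgA.
Qed.

Definition principal_space (f : group_ring G) : Type := principal_set f.

Section PrincipalSpace.
Variable f : group_ring G.
Implicit Types v w : principal_space f.

Definition principal_in v : principal_set f (\val v) := set_mem (valP v).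

Definition principal0 : principal_space f := SigSub (mem_set (@principal_set0 f)).
Definition principalD v w : principal_space f :=
  SigSub (mem_set (principal_setD (principal_in v) (principal_in w))).
Definition principalN v : principal_space f :=
  SigSub (mem_set (principal_setN (principal_in v))).

Lemma principalDA : associative principalD.
Proof. by move=> u v w; apply: val_inj; rewrite /= addrA. Qed.
Lemma principalDC : commutative principalD.
Proof. by move=> u v; apply: val_inj; rewrite /= addrC. Qed.
Lemma principal0D : left_id principal0 principalD.
Proof. by move=> u; apply: val_inj; rewrite /= add0r. Qed.
Lemma principalND : left_inverse principal0 principalN principalD.
Proof. by move=> u; apply: val_inj; rewrite /= addNr. Qed.

HB.instance Definition _ :=
  Topological.copy (principal_space f) (set_type (principal_set f)).
HB.instance Definition _ := GRing.isZmodule.Build (principal_space f)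
  principalDA principalDC principal0D principalND.

Definition principal_action (a : G) (v : principal_space f) : principal_space f :=
  SigSub (mem_set (principal_set_shift a (principal_in v))).

End PrincipalSpace.
End Shift.

Section Expansive.
Variable R : realType.

Record invariant_metric (X : PreTopologicalZmodule.type) (d : X -> X -> R) : Prop :=
  InvariantMetric {
    imetric_eq0 : forall v w, d v w = 0 <-> v = w;
    imetric_sym : forall v w, d v w = d w v;
    imetric_triangle : forall u v w, d u w <= d u v + d v w;
    imetric_invariant : forall u v w, d (v + u) (w + u) = d v w;
    imetric_nbhs : forall (v : X) (A : set X),
      nbhs v A <-> exists2 e : R, 0 < e & [set w | d v w < e] `<=` A
  }.

(* [ereal_sup] because the metric is not assumed bounded. *)
Definition expansive (Gamma X : Type) (alpha : Gamma -> X -> X)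
    (d : X -> X -> R) : Prop :=
  exists2 eps : R, 0 < eps &
    forall v w : X, v <> w ->
      (eps%:E < ereal_sup [set (d (alpha g v) (alpha g w))%:E | g in setT])%E.

End Expansive.

(* Main.v *)
(** Write (a, b, c) for the entries (0,1), (0,2), (1,2) of an element of the
    Heisenberg group and chi = e(alpha), e(t) = exp(2 i pi t). The function
    w(a, b, c) = e(alpha b + theta c) u_a is annihilated by f = g1 x - g0 as soon
    as u_{k+1} G1(theta + k alpha) = u_k G0(theta + k alpha) for all k, where
    G_i(t) = g_i(e(t), chi). A nonzero bounded real w annihilated by f contradicts
    expansiveness, because its small multiples modulo 1 have small orbits. By
    compactness it is enough that, for every r > 0, some finitely supported u with
    u_0 = 1 = max |u_k| satisfies the recursion up to an error r.
    Say m(g0) < m(g1). Take u_0 = 1 and follow the recursion on [0, n], extending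
    by 0: the only errors, at the two ends, are |G1(theta - alpha)| and
    |u_n G0(theta + n alpha)|. Both can be made small. Otherwise every orbit
    starting near a zero of G1 would have log|u_n| bounded below; since every orbit
    enters that neighbourhood within a bounded time, sum_{k<n} log|G1/G0| would be
    bounded above along all orbits, uniformly in n, and averaging over the circle
    would give m(g1) <= m(g0). The case m(g1) < m(g0) is the same with time
    reversed. *)
Require Import Defs.
From HB Require Import structures.
From mathcomp Require Import all_boot all_order all_algebra.
From mathcomp Require Import finmap.
From mathcomp Require Import all_classical all_reals all_analysis.
From mathcomp Require Import measurable_realfun.
From mathcomp Require Import complex.
From mathcomp Require Import -(notations) monalg.
From mathcomp Require Import ring lra zify.
Import Order.TTheory GRing.Theory Num.Theory.
Import numFieldNormedType.Exports.
Local Open Scope classical_set_scope.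
Local Open Scope ring_scope.

Set Implicit Arguments.
Unset Strict Implicit.
Unset Printing Implicit Defensive.

(** * Small real numbers as representatives of points near 0 on the circle *)

Section Torus.
Variable R : realType.

Definition to_torus (x : R) : torus R := \pi_(torus R)%qT x.

Fact to_torus_is_zmod_morphism : zmod_morphism to_torus.
Proof. exact: (@pi_is_zmod_morphism _ _ _ (torus R)). Qed.
HB.instance Definition _ :=
  GRing.isZmodMorphism.Build R (torus R) to_torus to_torus_is_zmod_morphism.

Lemma to_torus_eq0 (x : R) : (to_torus x == 0) = (x \is a Num.int).
Proof.
rewrite -(raddf0 to_torus) /to_torus.
have := Quotient.idealrBE (integers_closed R) x 0; rewrite subr0 => <-.
by [].
Qed.

Lemma nbhs0_torus (V : set (torus R)) : nbhs (0 : torus R) V ->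
  exists2 r : R, 0 < r & forall x, `|x| < r -> V (to_torus x).
Proof.
rewrite nbhsE; case=> O [oO O0] OV.
have oO' : open (to_torus @^-1` O) by [].
have O0' : (to_torus @^-1` O) 0 by rewrite /= raddf0.
have /nbhs_ballP[r r0 rO] := open_nbhs_nbhs (conj oO' O0').
exists r => // x xr; apply: OV; apply: rO.
by rewrite /ball /= sub0r normrN.
Qed.

End Torus.

(** * The equations defining the principal space, over arbitrary coefficients *)

Section Convolution.
Variable G : groupType.
Implicit Types (f : group_ring G) (V U : zmodType).

(** The values lie in any abelian group, so that one expression covers the equations over the torus,
    over the reals and over the complex numbers. *)
Definition conv V f (w : G -> V) (b : G) : V :=
  \sum_(a <- msupp f) w (b * a)%g *~ mcoeff a f.

Lemma conv_supp V (d : {fset G}) f (w : G -> V) b : (msupp f `<=` d)%fset ->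
  conv f w b = \sum_(a <- d) w (b * a)%g *~ mcoeff a f.
Proof.
move=> fd; apply: big_fset_incl => // a _ /mcoeff_outdom ->; exact: mulr0z.
Qed.

Lemma convB V f g (w : G -> V) b : conv (f - g) w b = conv f w b - conv g w b.
Proof.
rewrite (conv_supp _ _ (fsubsetUl (msupp f) (msupp g))).
rewrite (conv_supp _ _ (fsubsetUr (msupp f) (msupp g))).
rewrite (conv_supp _ _ (msuppB_le f g)) -sumrB.
by apply: eq_bigr => a _; rewrite mcoeffB mulrzBr.
Qed.

Lemma conv_sum V (I : Type) (r : seq I) (F : I -> group_ring G) (w : G -> V) b :
  conv (\sum_(i <- r) F i) w b = \sum_(i <- r) conv (F i) w b.
Proof.
have conv0 : conv (0 : group_ring G) w b = 0 by have := convB 0 0 w b; rewrite !subrr.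
apply: (big_morph (fun f => conv f w b)) => // f g.
by rewrite -{1}[g]opprK convB -[- g]sub0r convB conv0 sub0r opprK.
Qed.

Lemma convU V (w : G -> V) b a (k : int) :
  conv (<< k *g a >> : group_ring G) w b = w (b * a)%g *~ k.
Proof. by rewrite (conv_supp _ _ msuppU_le) big_seq_fset1 mcoeffUU. Qed.

(** Integer combinations commute with additive maps. This serves twice: for the reduction of a real
    solution modulo 1, and for the real part of a complex one. *)
Lemma raddf_conv V U (h : {additive V -> U}) f (w : G -> V) b :
  h (conv f w b) = conv f (h \o w) b.
Proof. by rewrite raddf_sum; apply: eq_bigr => a _; rewrite raddfMz. Qed.

End Convolution.

(** * From approximate real solutions to non-expansiveness *)

Section Approximation.
Variables (R : realType) (G : groupType) (f : group_ring G).

(** The sets [B r] generate a filter. It converges to 0 in each coordinate, hence in the product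
    topology, so every neighbourhood of 0 contains some [B r]. *)
Lemma nbhs0_shift_space (U : set (shift_space R G)) :
  nbhs (0 : shift_space R G) U ->
  exists2 r : R, 0 < r &
    forall s : G -> R, (forall a, `|s a| < r) -> U (fun a => to_torus (s a)).
Proof.
pose B (r : R) : set (shift_space R G) :=
  [set v | exists2 s : G -> R, (forall a, `|s a| < r) & v = fun a => to_torus (s a)].
pose F := filter_from [set r : R | 0 < r] B.
have FF : Filter F.
  apply: filter_from_filter; first by exists 1 => /=.
  move=> r r' /= r0 r'0; exists (Num.min r r'); first by rewrite /= lt_min r0.
  by move=> v [s sr ->]; split; exists s => // a;
    have := sr a; rewrite lt_min => /andP[].
have : F --> (0 : shift_space R G).
  apply/cvg_sup => a A.
  rewrite nbhsE; case=> _ [[C oC <-] C0] CA.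
  have /nbhs0_torus[r r0 rC] := open_nbhs_nbhs (conj oC C0).
  exists r => // v [s sr ->]; apply: CA; exact: rC.
move=> cF /cF[r r0 BU]; exists r => // s sr.
by apply: BU; exists s.
Qed.

(** Modulo 1, a small multiple e w is a nonzero point of the space; w being bounded, all its
    translates are uniformly small, so its whole orbit stays close to the fixed point 0. *)
Lemma bounded_kernel_nonexpansive (w : G -> R)
    (d : principal_space R f -> principal_space R f -> R) :
  (forall a, `|w a| <= 1) -> w 1%g = 1 -> (forall b, conv f w b = 0) ->
  invariant_metric d -> ~ expansive (@principal_action R G f) d.
Proof.
move=> w1 w1E wf hd [eps eps0 Hd].
have : nbhs (0 : principal_space R f) [set v | d 0 v < eps / 2].
  by apply/(imetric_nbhs hd); exists (eps / 2) => //; exact: divr_gt0.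
rewrite nbhsE; case=> _ [[V oV <-] V0] VU.
have /nbhs0_shift_space[r r0 rO] := open_nbhs_nbhs (conj oV V0).
(* [e < r] keeps all values in the neighbourhood; 0 < e < 1 keeps the value e at the identity away
   from the integers, so that the point is not 0. *)
pose e : R := Num.min (r / 2) 2^-1.
have e0 : 0 < e by rewrite lt_min divr_gt0 //= invr_gt0.
have er : e < r by rewrite gt_min ltr_pdivrMr // ltr_pMr // ltr1n.
have e1 : e < 1 by rewrite gt_min [X in _ || X]invf_lt1 // ?ltr1n ?orbT.
have key (s : G -> R) : (forall b, conv f s b = 0) ->
    principal_set f (fun a => to_torus (s a) : torus R).
  by move=> sf b; rewrite -[RHS](raddf0 (@to_torus R)) -(sf b) raddf_conv.
have ewf : forall b, conv f (fun a => e * w a) b = 0.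
  move=> b; rewrite -[RHS](mulr0 e) -(wf b) mulr_sumr.
  by apply: eq_bigr => a _; rewrite mulrzAr.
pose v : principal_space R f := SigSub (mem_set (key _ ewf)).
have v0 : v <> 0.
  move=> /(congr1 (fun v => \val v 1%g)) /= /eqP.
  rewrite w1E mulr1 to_torus_eq0 => /intrP[k ek].
  by move: e0 e1; rewrite ek ltr0z ltrz1 gtz0_ge1 => /le_lt_trans/[apply]; rewrite ltxx.
have := Hd v 0 v0; apply/negP; rewrite -leNgt.
apply: (@le_trans _ _ (eps / 2)%:E); last first.
  by rewrite lee_fin ler_pdivrMr // ler_pMr // ler1n.
apply: ge_ereal_sup => _ [g _ <-]; rewrite lee_fin ltW //.
have -> : principal_action g (0 : principal_space R f) = 0.
  by apply: val_inj; apply/funext => a.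
rewrite (imetric_sym hd); apply: VU => /=.
apply: (rO (fun a => e * w (g^-1 * a)%g)) => a.
by rewrite normrM (gtr0_norm e0) (le_lt_trans _ er) // ler_piMr // ltW.
Qed.

(** By Tychonoff, the approximate solutions have a cluster point in [-1, 1]^G as r tends to 0. Each
    equation involves finitely many coordinates, so it is continuous and holds exactly in the
    limit. *)
Lemma approximate_kernel :
  (forall r : R, 0 < r -> exists w : G -> R,
     [/\ forall a, `|w a| <= 1, w 1%g = 1 & forall b, `|conv f w b| <= r]) ->
  exists w : G -> R,
    [/\ forall a, `|w a| <= 1, w 1%g = 1 & forall b, conv f w b = 0].
Proof.
move=> H.
pose A : set (prod_topology (fun _ : G => R : topologicalType)) :=
  [set w | forall a, `[-1, 1]%classic (w a)].
have cA : compact A.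
  apply: (@tychonoff G (fun=> R : topologicalType) (fun=> `[-1, 1]%classic)) => a.
  exact: (@segment_compact R (-1) 1).
pose B (r : R) := A `&` [set w | w 1%g = 1 /\ forall b, `|conv f w b| <= r].
pose F := filter_from [set r : R | 0 < r] B.
have FF : ProperFilter F.
  apply: filter_from_proper => [|r /= /H[w [w1 w1E wf]]]; last first.
    by exists w; split=> // a; rewrite /= in_itv /= -ler_norml.
  apply: filter_from_filter; first by exists 1 => /=.
  move=> r r' /= r0 r'0; exists (Num.min r r'); first by rewrite /= lt_min r0.
  move=> v [Av [v1 vf]]; split; (do 2 split => //) => b;
    by have := vf b; rewrite le_min => /andP[].
have FA : F A by exists 1 => [/=|v []].
have [l [Al]] := cA F FF FA.
(* A cluster point is a genuine limit along a finer filter [U], which allows passing to the limit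
   coordinate by coordinate. *)
rewrite cluster_cvgE => [[U UU [Ul FU]]].
have ev a : (v a) @[v --> U] --> (l a : R).
  by apply: (cvg_trans _ (@proj_continuous G (fun=> R) a l)); exact: cvg_app.
exists l; split=> [a||b].
- by have := Al a; rewrite /= in_itv /= ler_norml.
- by apply/eqP; rewrite eq_le; apply/andP; split;
    [apply: (cvgr_to_le (ev 1%g))|apply: (cvgr_to_ge (ev 1%g))];
    apply: FU; exists 1 => [/=|v [_ [-> _]]].
- have evf : conv f v b @[v --> U] --> conv f l b.
    apply: cvg_big => [|a _]; first exact: add_continuous.
    rewrite -mulrzr; under eq_fun do rewrite -mulrzr.
    by apply: cvgM; [exact: ev|exact: cvg_cst].
  apply/eqP; rewrite -normr_le0; apply/ler_addgt0Pl => r r0; rewrite addr0.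
  apply: (cvgr_to_le (cvg_norm evf)); apply: FU; exists r => // v [_ [_]].
  exact.
Qed.

End Approximation.

(** * Recurrence of irrational rotations, with uniform waiting times *)

Section Rotation.
Variable R : realType.
Implicit Types (alpha r t : R).

Definition irrational_rotation alpha :=
  forall (q : nat) (p : int), (0 < q)%N -> q%:R * alpha != p%:~R.

(** Dirichlet's pigeonhole argument: among N + 1 multiples of alpha, two have fractional parts in
    the same one of N boxes of length 1/N < r. *)
Lemma small_return alpha r : 0 < r ->
  exists2 q : nat, (0 < q)%N & exists p : int, `|q%:R * alpha - p%:~R| < r.
Proof.
move=> r0; pose N := (Num.truncn r^-1).+1.
have Nr : N%:R^-1 < r.
  by rewrite -[ltRHS]invrK ltf_pV2 ?posrE ?invr_gt0 // truncnS_gt.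
pose u (k : nat) : R := k%:R * alpha - (Num.floor (k%:R * alpha))%:~R.
have u01 k : 0 <= u k < 1.
  rewrite subr_ge0 floor_le /= ltrBlDr addrC.
  by have := floorD1_gt (k%:R * alpha); rewrite intrD.
have fN k : (Num.truncn (N%:R * u k) < N)%N.
  have /andP[u0 u1] := u01 k.
  rewrite -(ltr_nat R) (@le_lt_trans _ _ (N%:R * u k)) ?truncn_le ?mulr_ge0 //.
  by rewrite -[ltRHS]mulr1 ltr_pM2l.
pose f (k : 'I_N.+1) : 'I_N := Ordinal (fN k).
have /injectivePn[x [y xy fxy]] : ~~ injectiveb f.
  by apply/injectiveP => /leq_card; rewrite !card_ord ltnn.
have {fxy} close : `|u x - u y| < r.
  apply: lt_trans Nr; rewrite -[ltRHS]mulr1 ltr_pdivlMl //.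
  rewrite -[X in X * _]ger0_norm // -normrM mulrBr.
  have /andP[ux _] := u01 x; have /andP[uy _] := u01 y.
  have /andP := truncn_itv (mulr_ge0 (ler0n R N) ux).
  have /andP := truncn_itv (mulr_ge0 (ler0n R N) uy).
  move/(congr1 val): fxy => /= ->; rewrite -natr1 => -[? ?] [? ?].
  by rewrite ltr_norml; lra.
wlog: x y xy close / (x < y)%N => [H|xly].
  have [xly|ylx] := ltnP x y; first exact: H xly.
  by apply: (H y x); rewrite 1?eq_sym 1?distrC // ltn_neqAle eq_sym xy.
exists (y - x)%N; first by rewrite subn_gt0.
exists (Num.floor (y%:R * alpha) - Num.floor (x%:R * alpha)).
rewrite distrC; congr (`|_| < r): close.
by rewrite /u natrB 1?ltnW // rmorphB /=; ring.
Qed.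

(** Some q turns amount to a nonzero displacement theta smaller than r. Its multiples sweep the
    circle in about 1/|theta| moves, a number independent of the starting point. *)
Lemma uniformly_recurrent_rotation alpha r t0 : irrational_rotation alpha -> 0 < r ->
  exists J : nat, forall t, exists2 j : nat, (j <= J)%N &
    exists m : int, `|t + j%:R * alpha - t0 - m%:~R| < r.
Proof.
move=> irr r0; have [q q0 [p qp]] := small_return alpha r0.
pose theta := q%:R * alpha - p%:~R.
have th0 : 0 < `|theta| by rewrite normr_gt0 subr_eq0 irr.
exists (q * Num.truncn `|theta|^-1)%N => t.
have [s [s1 ss sth]] : exists s : int,
    [/\ `|s| = 1, s * s = 1 & `|theta| = s%:~R * theta].
  by have [th|th] := ger0P theta; [exists 1|exists (-1)]; split=> //;
    rewrite ?mul1r // mulN1r.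
have s21 : s%:~R * s%:~R = 1 :> R by rewrite -rmorphM /= ss.
(* With s the sign of theta, x is the distance modulo 1 from t to t0 in the direction of motion; i
   moves of length |theta| then stop short of t0 by less than |theta|. *)
pose y : R := s%:~R * (t0 - t); pose x := y - (Num.floor y)%:~R.
have x0 : 0 <= x by rewrite subr_ge0 floor_le.
have x1 : x < 1 by have := floorD1_gt y; rewrite intrD /x; lra.
pose i := Num.truncn (x / `|theta|).
exists (q * i)%N.
  rewrite leq_mul2l; apply/orP; right; apply: le_truncn.
  by rewrite ler_piMl ?invr_ge0 // ltW.
exists (- s * Num.floor y + i%:Z * p).
have -> : t + (q * i)%:R * alpha - t0 - (- s * Num.floor y + i%:Z * p)%:~R =
    - s%:~R * (x - i%:R * `|theta|).
  rewrite sth /x /y /theta rmorphD !rmorphM rmorphN /= -?pmulrn.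
  transitivity (- (s%:~R * s%:~R) * (t0 - t) + s%:~R * (Num.floor y)%:~R
    + (s%:~R * s%:~R) * i%:R * (q%:R * alpha - p%:~R)); last by rewrite /y; ring.
  by rewrite s21; ring.
rewrite normrM normrN -intr_norm s1 mul1r; apply: le_lt_trans qp; rewrite -/theta.
have /andP[] := truncn_itv (divr_ge0 x0 (ltW th0)); rewrite -/i.
rewrite ler_pdivlMr // ltr_pdivrMr // -natr1 mulrDl mul1r => h1 h2.
by rewrite ler_norml; lra.
Qed.

End Rotation.

(** * Integrals of possibly infinite logarithms and their averages along a rotation *)

Section Integral.
Variable R : realType.
Local Open Scope ereal_scope.
Notation mu := (@lebesgue_measure R).
Implicit Types (F : R -> \bar R) (a : R).

Let addr_mfun a (x : measurableTypeR R) : measurableTypeR R := (x + a)%R.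

Let measurable_addr_mfun a : measurable_fun [set: _] (addr_mfun a).
Proof. by apply: measurable_funD. Qed.

(** By uniqueness of Lebesgue measure, half-open intervals suffice. *)
Let lebesgue_translate a (A : set (measurableTypeR R)) : measurable A ->
  mu A = pushforward mu (addr_mfun a) A.
Proof.
pose f : {mfun (measurableTypeR R) >-> (measurableTypeR R)} :=
  HB.pack (addr_mfun a) (isMeasurableFun.Build _ _ _ _ _ (measurable_addr_mfun a)).
apply: (@lebesgue_measure_unique R (pushforward mu f)) => _ [[x y] _ <-] /=.
rewrite /pushforward.
have -> : f @^-1` `]x, y]%classic = `](x - a)%R, (y - a)%R]%classic.
  by apply/seteqP; split => z; rewrite /= !in_itv /= /addr_mfun ltrBlDr lerBrDr.
rewrite !lebesgue_measure_itv /= !lte_fin ltrD2r; case: ifP => // _.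
by rewrite -!EFinB; congr EFin; ring.
Qed.

Lemma ge0_integral_translate F a (D : set R) : measurable D ->
  measurable_fun setT F -> (forall x, 0 <= F x) ->
  \int[mu]_(x in [set x | D (x + a)%R]) F (x + a)%R = \int[mu]_(x in D) F x.
Proof.
move=> mD mF F0.
pose f : {mfun (measurableTypeR R) >-> (measurableTypeR R)} :=
  HB.pack (addr_mfun a) (isMeasurableFun.Build _ _ _ _ _ (measurable_addr_mfun a)).
rewrite [RHS](eq_measure_integral (pushforward mu f)); last first.
  by move=> A mA _; exact: lebesgue_translate.
by rewrite ge0_integral_pushforward //; exact: measurable_funTS.
Qed.

(** After reduction to 0 <= a < 1, translation gives the integral over [a, a + 1]; the piece beyond
    1 is moved back by one period. *)
Lemma ge0_integral_rotate F a :
  measurable_fun setT F -> (forall x, 0 <= F x) ->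
  (forall x (m : int), F (x + m%:~R)%R = F x) ->
  \int[mu]_(x in `[0%R, 1%R]) F (x + a)%R = \int[mu]_(x in `[0%R, 1%R]) F x.
Proof.
move=> mF F0 Fper.
wlog /andP[a0 a1] : a / (0 <= a < 1)%R => [H|].
  rewrite -(H (a - (Num.floor a)%:~R)%R).
    by apply: eq_integral => x _; rewrite addrA -rmorphN Fper.
  rewrite subr_ge0 floor_le /= ltrBlDr addrC.
  by have := floorD1_gt a; rewrite intrD.
have oc b c : \int[mu]_(x in `[b, c]) F x = \int[mu]_(x in `]b, c]) F x.
  by rewrite -integral_itv_obnd_cbnd //; exact: measurable_funTS.
transitivity (\int[mu]_(x in `[a, (a + 1)%R]) F x).
  rewrite -[RHS](ge0_integral_translate a) //; congr integral.
  by apply/seteqP; split => z; rewrite /= !in_itv /=; lra.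
have split b c d : (b <= c <= d)%R -> \int[mu]_(x in `]b, d]) F x =
    \int[mu]_(x in `]b, c]) F x + \int[mu]_(x in `]c, d]) F x.
  move=> /andP[bc cd].
  rewrite -ge0_integral_setU //; first last.
  - apply/disj_setPS => z [/=]; rewrite !in_itv /=; lra.
  - exact: measurable_funTS.
  - congr integral; apply/seteqP; split => z /=; rewrite !in_itv /=.
      by case: (leP z c) => zc; [left|right]; lra.
    by case; lra.
rewrite !oc (split a 1%R) 1?(split 0%R a 1%R) ?a0 ?(ltW a1) //=; last first.
  by rewrite lerDr.
rewrite addeC; congr (_ + _); rewrite -[LHS](ge0_integral_translate 1%R) //.
under eq_integral do rewrite (Fper _ 1%:Z).
by congr integral; apply/seteqP; split => z; rewrite /= !in_itv /=; lra.
Qed.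

Notation I01 := (`[0%R, 1%R]%classic : set R).

Lemma measurable_lne_comp (P : R -> R) : measurable_fun setT P ->
  measurable_fun setT (fun x => lne (P x)%:E).
Proof.
move=> mP; apply: measurable_fun_ifT => //=.
- by apply: measurable_fun_ler => //; exact: measurable_cst.
- by apply/measurable_EFinP; exact: measurableT_comp.
Qed.

(** The integral of F may be -oo. The identity F^+ + (L - F) = L + F^- has only nonnegative terms,
    so it can be integrated; F^+ <= L makes the integral of F^+ finite, and it can be subtracted. *)
Lemma integral_cstB (F : R -> \bar R) (L : R) : measurable_fun setT F ->
  (0 <= L)%R -> (forall x, F x <= L%:E) ->
  \int[mu]_(x in I01) (L%:E - F x) = L%:E - \int[mu]_(x in I01) F x.
Proof.
move=> mF L0 FL.
have mu01 : mu I01 = 1 by rewrite lebesgue_measure_itv /= lte_fin ltr01 sube0.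
have mL : measurable_fun setT (fun x => L%:E - F x).
  by apply: emeasurable_funB => //; exact: measurable_cst.
have mI (G : R -> \bar R) : measurable_fun setT G -> measurable_fun I01 G.
  by move=> mG; exact: measurable_funTS.
have Lint : \int[mu]_(x in I01) (cst L%:E) x = L%:E.
  by rewrite integral_cst // [X in _ * X]mu01 mule1.
have Fpos : 0 <= \int[mu]_(x in I01) F^\+ x <= L%:E.
  rewrite integral_ge0 //= -[leRHS]Lint.
  apply: ge0_le_integral => //; first by apply: mI; exact: measurable_funepos.
  by move=> x _; rewrite funeposE /cst ge_max FL lee_fin.
have : \int[mu]_(x in I01) F^\+ x + \int[mu]_(x in I01) (L%:E - F x) =
    L%:E + \int[mu]_(x in I01) F^\- x.
  rewrite -[X in _ = X + _]Lint -!ge0_integralD //.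
  - apply: eq_integral => x _; rewrite funeposE funenegE /cst.
    case: (F x) (FL x) => [r| |] // _; last first.
      by rewrite maxNye maxye addey // addey.
    rewrite -EFinB -EFinN -!EFin_max -!EFinD; congr EFin.
    by case: (leP r 0%R); case: (leP (- r)%R 0%R); lra.
  - by apply: mI; exact: measurable_funeneg.
  - by apply: mI; exact: measurable_funepos.
  - by move=> x _; rewrite sube_ge0 ?FL ?orbT.
  - exact: mI.
rewrite [in X in _ -> _ = X]integralE.
case/andP: Fpos; case: (\int[mu]_(x in I01) F^\+ x) => [p| |] // p0 pL.
have : 0 <= \int[mu]_(x in I01) F^\- x by apply: integral_ge0.
case: (\int[mu]_(x in I01) F^\- x) => [q| |] // _;
  case: (\int[mu]_(x in I01) (L%:E - F x)) => [s| |] //= [E]; congr EFin; lra.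
Qed.

(* [log M - log|g|] with values in [[0, +oo]]: no integrability of [log|g|] is
   needed, which also covers [g = 0]. *)
Definition deficit (L x : R) : \bar R := L%:E - lne x%:E.

Lemma deficit_EFin (L x : R) : (0 < x)%R -> deficit L x = (L - ln x)%:E.
Proof. by move=> x0; rewrite /deficit lne_EFin. Qed.

Lemma deficit0 L : deficit L 0%R = +oo.
Proof. by rewrite /deficit le0_lneNy. Qed.

Lemma le_lne_ln (M x : R) : (0 < M)%R -> (0 <= x <= M)%R -> lne x%:E <= (ln M)%:E.
Proof.
move=> M0 /andP[]; rewrite le_eqVlt => /predU1P[<- _|x0 xM].
  by rewrite le0_lneNy ?leNye.
by rewrite lne_EFin // lee_fin ler_ln.
Qed.

Lemma deficit_ge0 (M x : R) : (0 < M)%R -> (0 <= x <= M)%R -> 0 <= deficit (ln M) x.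
Proof. by move=> M0 xM; rewrite sube_ge0 ?le_lne_ln //= orbT. Qed.

Lemma measurable_deficit L (P : R -> R) : measurable_fun setT P ->
  measurable_fun setT (fun x => deficit L (P x)).
Proof.
move=> mP; apply: emeasurable_funB; first exact: measurable_cst.
exact: measurable_lne_comp.
Qed.

(** Truncating P from below at 1/(n + 1) gives deficits that increase with n to that of P, with
    limit +oo at the zeros of P; monotone convergence applies. The bound e <= 1 <= M keeps the
    truncated deficits nonnegative. *)
Lemma integral_deficit_le_truncated (P : R -> R) (M : R) (B : \bar R) :
  measurable_fun setT P -> (1 <= M)%R -> (forall x, 0 <= P x <= M)%R ->
  (forall e : R, (0 < e <= 1)%R ->
    \int[mu]_(x in I01) deficit (ln M) (Num.max (P x) e) <= B) ->
  \int[mu]_(x in I01) deficit (ln M) (P x) <= B.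
Proof.
move=> mP M1 PM HB.
have M0 : (0 < M)%R by exact: lt_le_trans M1.
pose e (n : nat) : R := n.+1%:R^-1%R.
have e01 n : (0 < e n <= 1)%R by rewrite invr_gt0 ltr0n /= invf_le1 ?ler1n ?ltr0n.
pose g n x := deficit (ln M) (Num.max (P x) (e n)).
have maxM n x : (0 <= Num.max (P x) (e n) <= M)%R.
  have /andP[e0 e1] := e01 n; have /andP[P0 P1] := PM x.
  by rewrite le_max P0 /= ge_max P1 (le_trans e1).
have max0 n x : (0 < Num.max (P x) (e n))%R.
  by have /andP[e0 _] := e01 n; rewrite lt_max e0 orbT.
have mg n : measurable_fun setT (g n).
  by apply: measurable_deficit; apply: measurable_maxr => //; exact: measurable_cst.
have g0 n x : 0 <= g n x by exact: deficit_ge0.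
have ndg x : nondecreasing_seq (g ^~ x).
  move=> m n mn; rewrite /g !deficit_EFin // lee_fin lerB // ler_ln ?posrE //.
  rewrite ge_max le_max lexx /= le_max; apply/orP; right.
  by rewrite lef_pV2 ?posrE ?ltr0n // ler_nat.
have gP x : g ^~ x @ \oo --> deficit (ln M) (P x).
  have /andP[] := PM x; rewrite le_eqVlt => /predU1P[Px0 _|Px0 _].
    rewrite -Px0 deficit0; apply/cvgeyPge => A.
    have := near_infty_natSinv_lt (PosNum (expR_gt0 (ln M - A)%R)).
    apply: filterS => n /ltW en; rewrite /g deficit_EFin // lee_fin.
    rewrite lerBrDl -lerBrDr -ler_expR lnK ?posrE //.
    by rewrite ge_max -Px0 expR_ge0.
  apply: cvg_near_cst; have := near_infty_natSinv_lt (PosNum Px0).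
  by apply: filterS => n /ltW en; rewrite /g max_l.
have -> : \int[mu]_(x in I01) deficit (ln M) (P x) =
    \int[mu]_(x in I01) limn (g ^~ x).
  by apply: eq_integral => x _; rewrite (cvg_lim _ (gP x)).
rewrite monotone_convergence //; last first.
- by move=> n; exact: measurable_funTS (mg n).
apply: lime_le; last by apply: nearW => n; exact: HB.
apply: ereal_nondecreasing_is_cvgn => m n mn.
by apply: ge0_le_integral => //;
  [exact: measurable_funTS (mg m)|exact: measurable_funTS (mg n)|move=> x _; exact: ndg].
Qed.

(** This is the logarithm of the inequality between products. If some [q k] vanishes, the right-hand
    side is +oo, which is why the product inequality is only assumed for positive factors. *)
Lemma sum_deficit_le (L d : R) (p q : nat -> R) n : (0 < d)%R ->
  (forall k, 0 < p k)%R -> (forall k, 0 <= q k)%R ->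
  (forall k, 0 <= deficit L (q k)) ->
  ((forall k, (k < n)%N -> 0 < q k) ->
    d * \prod_(k < n) q k <= \prod_(k < n) p k)%R ->
  \sum_(k < n) deficit L (p k) <= \sum_(k < n) deficit L (q k) + (- ln d)%:E.
Proof.
move=> d0 p0 q0 D0 H.
have [q1|] := pselect (forall k, (k < n)%N -> 0 < q k)%R; last first.
  move=> /existsNP[k /not_implyP[kn /negP]]; rewrite -leNgt => qk.
  have qk0 : q k = 0%R by apply/eqP; rewrite eq_le qk q0.
  rewrite [X in _ <= X + _](bigD1 (Ordinal kn)) //= qk0 deficit0 addye.
    by rewrite addye ?leey.
  by rewrite gt_eqF // (lt_le_trans ltNy0) // sume_ge0.
have lnprod (u : nat -> R) m : (forall k, (k < m)%N -> 0 < u k)%R ->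
    (0 < \prod_(k < m) u k /\ ln (\prod_(k < m) u k) = \sum_(k < m) ln (u k))%R.
  elim: m => [|m IH] u0; first by rewrite !big_ord0 ln1.
  have [IH1 IH2] : _ /\ _ := IH (fun k km => u0 k (ltnW km)).
  rewrite !big_ord_recr /= mulr_gt0 ?u0 //; split=> //.
  by rewrite lnM ?posrE ?u0 // IH2.
under eq_bigr do rewrite deficit_EFin //.
under [X in _ <= X + _]eq_bigr => k _ do rewrite deficit_EFin ?q1 //.
rewrite !sumEFin -EFinD lee_fin !sumrB.
have [P0 Pln] := lnprod p n (fun k _ => p0 k); have [Q0 Qln] := lnprod q n q1.
have := H q1; rewrite -ler_ln ?posrE ?mulr_gt0 // lnM ?posrE // Pln Qln; lra.
Qed.

(** By contradiction: otherwise sums of deficits of P0 and P1 along orbits compare up to a constant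
    independent of t and n. Integration over t turns each sum into a multiple of one integral, and
    large n contradicts the strict inequality. *)
Lemma exists_small_product (P0 P1 : R -> R) (M alpha t0 d : R) :
  continuous P0 -> continuous P1 -> (1 <= M)%R ->
  (forall x, 0 <= P0 x <= M)%R -> (forall x, 0 <= P1 x <= M)%R ->
  (forall x (m : int), P0 (x + m%:~R) = P0 x)%R ->
  (forall x (m : int), P1 (x + m%:~R) = P1 x)%R ->
  P1 t0 = 0%R -> irrational_rotation alpha -> (0 < d)%R ->
  \int[mu]_(x in I01) lne (P0 x)%:E < \int[mu]_(x in I01) lne (P1 x)%:E ->
  exists (t : R) (n : nat), [/\ (P1 (t - alpha) < d)%R,
    (forall k, (k < n)%N -> 0 < P1 (t + k%:R * alpha))%R &
    (\prod_(k < n) P0 (t + k%:R * alpha) < d * \prod_(k < n) P1 (t + k%:R * alpha))%R].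
Proof.
move=> c0 c1 M1 B0 B1 per0 per1 P1t0 irr d0 lt01.
have M0 : (0 < M)%R by exact: lt_le_trans M1.
have mP0 : measurable_fun setT P0 by exact: continuous_measurable_fun.
have mP1 : measurable_fun setT P1 by exact: continuous_measurable_fun.
have lnM0 : (0 <= ln M)%R by exact: ln_ge0.
have D1 x : 0 <= deficit (ln M) (P1 x) by exact: deficit_ge0.
apply: contrapT => H.
have {}H t n : (P1 (t - alpha) < d)%R ->
    (forall k, (k < n)%N -> 0 < P1 (t + k%:R * alpha))%R ->
    (d * \prod_(k < n) P1 (t + k%:R * alpha) <= \prod_(k < n) P0 (t + k%:R * alpha))%R.
  by move=> Pt Pn; rewrite leNgt; apply/negP => lt; apply: H; exists t, n.
have [r r0 rP] : exists2 r : R, (0 < r)%R & forall x, (`|x - t0| < r -> P1 x < d)%R.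
  have : nbhs (P1 t0) [set y | (y < d)%R] by rewrite P1t0; exact: lt_nbhsl.
  move=> /(c1 t0)/nbhs_ballP[r r0 rP]; exists r => // x xr.
  by apply: rP; rewrite /ball /= distrC.
have [J JP] := uniformly_recurrent_rotation (t0 + alpha) irr r0.
have {JP r r0 rP} good t : exists2 j : nat, (j <= J)%N & (P1 (t + j%:R * alpha - alpha) < d)%R.
  have [j jJ [m jm]] := JP t; exists j => //.
  rewrite -(per1 _ (- m)%R); apply: rP.
  by congr (`|_| < r)%R: jm; rewrite rmorphN /=; ring.
(* The same M serves both functions, so comparing deficits is comparing the logarithmic integrals in
   reverse order. *)
suff : \int[mu]_(x in I01) deficit (ln M) (P0 x) <=
       \int[mu]_(x in I01) deficit (ln M) (P1 x).
  rewrite !integral_cstB //; last 4 first.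
  - exact: measurable_lne_comp.
  - by move=> x; exact: le_lne_ln.
  - exact: measurable_lne_comp.
  - by move=> x; exact: le_lne_ln.
  move: lt01.
  case: (\int[mu]_(x in I01) lne (P0 x)%:E) (\int[mu]_(x in I01) lne (P1 x)%:E)
    => [a| |] [b| |] //; rewrite ?lee_fin ?lte_fin; lra.
apply: integral_deficit_le_truncated => // e /andP[e0 e1].
pose Q x := Num.max (P0 x) e.
have Q0 x : (0 < Q x)%R by rewrite lt_max e0 orbT.
have QM x : (0 <= Q x <= M)%R.
  by rewrite ltW //= ge_max (le_trans e1) // andbT; case/andP: (B0 x).
have mQ : measurable_fun setT Q by apply: measurable_maxr => //; exact: measurable_cst.
have DQ x : 0 <= deficit (ln M) (Q x) by exact: deficit_ge0.
have DQe x : deficit (ln M) (Q x) <= (ln M - ln e)%:E.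
  by rewrite deficit_EFin // lee_fin lerB // ler_ln ?posrE // le_max lexx orbT.
have lnMe : (0 <= ln M - ln e)%R by rewrite subr_ge0 ler_ln ?posrE // (le_trans e1).
(* Each of the at most J steps before the orbit comes near t0 + alpha costs at most ln M - ln e,
   finite thanks to the truncation; |ln d| is the loss in [sum_deficit_le]. *)
pose C : R := (J%:R * (ln M - ln e) + `|ln d|)%R.
have C0 : (0 <= C)%R by rewrite addr_ge0 // mulr_ge0.
(* The waiting time j depends on t. Lengthening sums of nonnegative terms, first to j + n and then
   to J + n, removes this dependence. *)
have key n t : \sum_(k < n) deficit (ln M) (Q (t + k%:R * alpha)%R) <=
    \sum_(k < (J + n)%N) deficit (ln M) (P1 (t + k%:R * alpha)%R) + C%:E.
  have [j jJ Pj] := good t.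
  have jk k : (t + (j + k)%:R * alpha = t + j%:R * alpha + k%:R * alpha)%R.
    by rewrite natrD; ring.
  apply: (@le_trans _ _ (\sum_(k < (j + n)%N) deficit (ln M) (Q (t + k%:R * alpha)%R))).
    exact: (@lee_sum_nneg_ord _ (fun k => deficit (ln M) (Q (t + k%:R * alpha)%R))
      xpredT (fun k _ => DQ _) _ _ (leq_addl j n)).
  apply: (@le_trans _ _ (\sum_(k < (j + n)%N) deficit (ln M) (P1 (t + k%:R * alpha)%R)
      + C%:E)); last first.
    apply: leeD2r.
    exact: (@lee_sum_nneg_ord _ (fun k => deficit (ln M) (P1 (t + k%:R * alpha)%R))
      xpredT (fun k _ => D1 _) _ _ (leq_add jJ (leqnn n))).
  have shuffle (a1 a2 b1 b2 e3 e4 : \bar R) : a1 <= e3 -> 0 <= b1 -> a2 <= b2 + e4 ->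
      a1 + a2 <= (b1 + b2) + (e3 + e4).
    move=> ac b0 abc; rewrite addeACA; apply: leeD => //.
    by rewrite -[leLHS]add0e; exact: leeD.
  rewrite !big_split_ord /C EFinD; apply: shuffle.
  - apply: (@le_trans _ _ (\sum_(k < j) (ln M - ln e)%:E)); first exact: lee_sum.
    by rewrite sumEFin lee_fin sumr_const card_ord -[leLHS]mulr_natl ler_wpM2r // ler_nat.
  - exact: sume_ge0.
  - under eq_bigr do rewrite /= jk.
    under [X in _ <= X + _]eq_bigr do rewrite /= jk.
    apply: le_trans (@sum_deficit_le (ln M) d
      (fun k => Q (t + j%:R * alpha + k%:R * alpha)%R)
      (fun k => P1 (t + j%:R * alpha + k%:R * alpha)%R) n d0 _ _ _ _) _ => //.
    - by move=> k; case/andP: (B1 (t + j%:R * alpha + k%:R * alpha)%R).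
    - move=> Pn; apply: le_trans (H _ _ Pj Pn) _; apply: ler_prod => k _.
      by rewrite le_max lexx andbT; case/andP: (B0 (t + j%:R * alpha + k%:R * alpha)%R).
    - by apply: leeD2l; rewrite lee_fin -normrN ler_norm.
have mshift (P : R -> R) n : measurable_fun setT P ->
    measurable_fun setT
      (fun x : R => \sum_(k < n) deficit (ln M) (P (x + k%:R * alpha)%R)).
  move=> mP; apply: emeasurable_sum => k; apply: measurable_deficit.
  by apply: measurableT_comp => //; exact: measurable_funD.
have intsum (P : R -> R) n : measurable_fun setT P ->
    (forall x, 0 <= P x <= M)%R -> (forall x (m : int), P (x + m%:~R) = P x)%R ->
    \int[mu]_(x in I01) (\sum_(k < n) deficit (ln M) (P (x + k%:R * alpha)%R)) =
    n%:R%:E * \int[mu]_(x in I01) deficit (ln M) (P x).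
  move=> mP PM perP.
  have mD : measurable_fun setT (fun x => deficit (ln M) (P x)) by exact: measurable_deficit.
  rewrite ge0_integral_sum //; last 2 first.
  - move=> k; apply: measurable_funTS; apply: measurable_deficit.
    by apply: measurableT_comp => //; exact: measurable_funD.
  - by move=> k x _; exact: deficit_ge0.
  under eq_bigr => k _.
    rewrite (@ge0_integral_rotate (fun x => deficit (ln M) (P x))) //; last 2 first.
    - by move=> x; exact: deficit_ge0.
    - by move=> x m; rewrite perP.
    over.
  by rewrite sumr_const card_ord mule_natl.
have {}key n : n%:R%:E * \int[mu]_(x in I01) deficit (ln M) (Q x) <=
    (J + n)%:R%:E * \int[mu]_(x in I01) deficit (ln M) (P1 x) + C%:E.
  rewrite -!intsum //; last by move=> x m; rewrite /Q per0.
  have -> : C%:E = \int[mu]_(x in I01) (cst C%:E) x.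
    by rewrite integral_cst // [X in _ * X]lebesgue_measure_itv /= lte_fin ltr01 sube0 mule1.
  rewrite -ge0_integralD //; last 2 first.
  - by move=> x _; exact: sume_ge0.
  - exact: measurable_funTS (mshift _ _ mP1).
  apply: ge0_le_integral => //.
  - by move=> x _; exact: sume_ge0.
  - exact: measurable_funTS (mshift _ _ mQ).
  - apply: measurable_funTS; apply: emeasurable_funD; first exact: mshift.
    exact: measurable_cst.
have : 0 <= \int[mu]_(x in I01) deficit (ln M) (P1 x) by exact: integral_ge0.
have : 0 <= \int[mu]_(x in I01) deficit (ln M) (Q x) by exact: integral_ge0.
move: key.
set A := \int[mu]_(x in I01) deficit (ln M) (Q x).
set B := \int[mu]_(x in I01) deficit (ln M) (P1 x) => key A0 B0'.
have [->|Bfin] := eqVneq B +oo; first by rewrite leey.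
have {}Bfin : B \is a fin_num by rewrite ge0_fin_numE // ltey.
(* The case n = 1 already bounds A by a finite quantity. *)
have Afin : A \is a fin_num.
  rewrite ge0_fin_numE //; have := key 1%N; rewrite mul1e => /le_lt_trans; apply.
  by rewrite -(fineK Bfin) -EFinM -EFinD ltry.
move: key A0 B0'; rewrite -(fineK Bfin) -(fineK Afin) !lee_fin => key.
move: (fine A) (fine B) key => a b key a0 b0; rewrite leNgt; apply/negP => ab.
(* If a > b, the inequality n a <= (J + n) b + C fails as soon as n > (J b + C) / (a - b). *)
have := key (Num.truncn ((J%:R * b + C) / (a - b))).+1.
rewrite -!EFinM -EFinD lee_fin natrD; apply/negP; rewrite -ltNge.
have := truncnS_gt ((J%:R * b + C) / (a - b)).
rewrite ltr_pdivrMr ?subr_gt0 //; lra.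
Qed.

End Integral.

(** * Coordinates on the Heisenberg group *)

Section HeisenbergCoordinates.
Implicit Types (a b : heisenberg) (m : int).

Let i0 : 'I_3 := inord 0.
Let i1 : 'I_3 := inord 1.
Let i2 : 'I_3 := inord 2.

Definition heis01 a : int := heis_mx a i0 i1.
Definition heis12 a : int := heis_mx a i1 i2.
Definition heis02 a : int := heis_mx a i0 i2.

Let sum3 (F : 'I_3 -> int) : \sum_i F i = F i0 + F i1 + F i2.
Proof.
rewrite !big_ord_recr big_ord0 /= add0r.
by congr (F _ + F _ + F _); apply: val_inj; rewrite /= inordK.
Qed.

Let mx_le a (i j : 'I_3) : (j <= i)%N -> heis_mx a i j = (i == j)%:R.
Proof. by move: i j; apply/unipotent_upperP; exact: (valP a). Qed.

Let mx_diag a i : heis_mx a i i = 1. Proof. by rewrite mx_le ?eqxx. Qed.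
Let mx10 a : heis_mx a i1 i0 = 0. Proof. by rewrite mx_le /= ?inordK // -val_eqE /= !inordK. Qed.
Let mx20 a : heis_mx a i2 i0 = 0. Proof. by rewrite mx_le /= ?inordK // -val_eqE /= !inordK. Qed.
Let mx21 a : heis_mx a i2 i1 = 0. Proof. by rewrite mx_le /= ?inordK // -val_eqE /= !inordK. Qed.

Let mxE3 := (mx_diag, mx10, mx20, mx21, mulr0, mul0r, mulr1, mul1r, addr0, add0r).

Lemma heis01M a b : heis01 (a * b)%g = heis01 a + heis01 b.
Proof. by rewrite /heis01 /= mxE sum3 !mxE3 addrC. Qed.

Lemma heis12M a b : heis12 (a * b)%g = heis12 a + heis12 b.
Proof. by rewrite /heis12 /= mxE sum3 !mxE3 addrC. Qed.

(** The mixed term is the source of the rotation: multiplying on the right by y shifts the central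
    coordinate by [heis01 a]. *)
Lemma heis02M a b : heis02 (a * b)%g = heis02 a + heis02 b + heis01 a * heis12 b.
Proof. by rewrite /heis02 /heis01 /heis12 /= mxE sum3 !mxE3; ring. Qed.

Lemma heis_coord1 : [/\ heis01 1%g = 0, heis12 1%g = 0 & heis02 1%g = 0].
Proof. by split; rewrite /heis01 /heis12 /heis02 /= mxE -val_eqE /= !inordK. Qed.

Lemma heis_coordx : [/\ heis01 hx = 1, heis12 hx = 0 & heis02 hx = 0].
Proof. by split; rewrite /heis01 /heis12 /heis02 /= !mxE -!val_eqE /= !inordK. Qed.

Lemma heis_coordy : [/\ heis01 hy = 0, heis12 hy = 1 & heis02 hy = 0].
Proof. by split; rewrite /heis01 /heis12 /heis02 /= !mxE -!val_eqE /= !inordK. Qed.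

Let heis_coordV a : [/\ heis01 a^-1%g = - heis01 a, heis12 a^-1%g = - heis12 a &
  heis02 a^-1%g = - heis02 a + heis01 a * heis12 a].
Proof.
have [h1 h2 h3] := heis_coord1.
have v1 : heis01 a^-1%g = - heis01 a.
  by apply/eqP; rewrite -addr_eq0 -heis01M mulVg h1.
have v2 : heis12 a^-1%g = - heis12 a.
  by apply/eqP; rewrite -addr_eq0 -heis12M mulVg h2.
split=> //; have := heis02M a^-1%g a; rewrite mulVg h3 v1; lia.
Qed.

Lemma heis_coordz : [/\ heis01 hz = 0, heis12 hz = 0 & heis02 hz = 1].
Proof.
have [x1 x2 x3] := heis_coordx; have [y1 y2 y3] := heis_coordy.
have [xi1 xi2 xi3] := heis_coordV hx; have [yi1 yi2 yi3] := heis_coordV hy.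
by split; rewrite /hz !(heis01M, heis12M, heis02M); lia.
Qed.

(** When [heis01 a = 0] the mixed term vanishes, so the coordinates are additive on powers of a. *)
Lemma heis_coord_exp a m : heis01 a = 0 ->
  [/\ heis01 (expgz a m) = 0, heis12 (expgz a m) = m * heis12 a &
      heis02 (expgz a m) = m * heis02 a].
Proof.
move=> a1; have [h1 h2 h3] := heis_coord1.
have expn n : [/\ heis01 (a ^+ n)%g = 0, heis12 (a ^+ n)%g = n%:Z * heis12 a &
      heis02 (a ^+ n)%g = n%:Z * heis02 a].
  elim: n => [|n [IH1 IH2 IH3]]; first by rewrite expg0 !mul0r.
  by rewrite expgS heis01M heis12M heis02M a1 IH1 IH2 IH3 mul0r; split; lia.
case: m => [n|n] //=; have [n1 n2 n3] := expn n.+1.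
have [v1 v2 v3] := heis_coordV (a ^+ n.+1)%g.
by rewrite NegzE v1 v2 v3 n1 n2 n3 mul0r; split; lia.
Qed.

Lemma heis_coord_yz (k : int * int) : let a := (expgz hy k.1 * expgz hz k.2)%g in
  [/\ heis01 a = 0, heis12 a = k.1 & heis02 a = k.2].
Proof.
have [y1 y2 y3] := heis_coordy; have [z1 z2 z3] := heis_coordz.
have [a1 a2 a3] := heis_coord_exp k.1 y1; have [b1 b2 b3] := heis_coord_exp k.2 z1.
by rewrite /= heis01M heis12M heis02M; split; lia.
Qed.

End HeisenbergCoordinates.

(** * Parametrisation of the unit circle *)

Section UnitCircle.
Variable R : realType.
Local Notation normc := (@Normc.normc R).

Definition expi (t : R) : R[i] := Complex (cos (2 * pi * t)) (sin (2 * pi * t)).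

Lemma expiD s t : expi (s + t) = expi s * expi t.
Proof. by rewrite /expi mulrDr cosD sinD; congr Complex; rewrite addrC. Qed.

Lemma expi0 : expi 0 = 1.
Proof. by rewrite /expi mulr0 cos0 sin0. Qed.

Lemma normc_expi t : normc (expi t) = 1.
Proof. by rewrite /= cos2Dsin2 sqrtr1. Qed.

Lemma expi_neq0 t : expi t != 0.
Proof.
by apply/eqP => /(congr1 normc); rewrite normc_expi Normc.normc0 => /eqP; rewrite oner_eq0.
Qed.

Lemma expiN t : expi (- t) = (expi t)^-1.
Proof.
by apply: (mulfI (expi_neq0 t)); rewrite -expiD subrr expi0 divff // expi_neq0.
Qed.

Lemma expi_int (m : int) t : expi (m%:~R * t) = expi t ^ m.
Proof.
have expn n : expi (n%:R * t) = expi t ^+ n.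
  elim: n => [|n IH]; first by rewrite mul0r expi0.
  by rewrite -natr1 mulrDl mul1r expiD IH exprSr.
case: m => n; first exact: expn.
by rewrite NegzE rmorphN mulNr expiN [X in expi (X * _)]/= expn exprnN.
Qed.

Lemma expi1 : expi 1 = 1.
Proof. by rewrite /expi mulr1 mulr_natl cos2pi sin2pi. Qed.

Lemma expi_periodic t (m : int) : expi (t + m%:~R) = expi t.
Proof. by rewrite expiD -[m%:~R]mulr1 expi_int expi1 exp1rz mulr1. Qed.

Lemma expi_surj (z : R[i]) : unit_circle z -> exists t, z = expi t.
Proof.
rewrite /unit_circle /= normc_def => -[]; case: z => x y /= xy1.
have {}xy1 : x ^+ 2 + y ^+ 2 = 1.
  by rewrite -[LHS]sqr_sqrtr ?addr_ge0 ?sqr_ge0 // xy1 expr1n.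
have x1 : -1 <= x <= 1.
  by apply/andP; split; nra.
have pi0 : 2 * pi != 0 :> R by rewrite mulf_neq0 // gt_eqF // pi_gt0.
(* [acos x] determines the angle up to sign; when y is the opposite of its sine, the opposite angle
   is taken. *)
have y2 : y ^+ 2 = sin (acos x) ^+ 2.
  by have := cos2Dsin2 (acos x); rewrite acosK // => E; lra.
have [|] := eqVneq y (sin (acos x)) => [->|ny].
  exists (acos x / (2 * pi)); rewrite /expi mulrC mulfVK // acosK //.
exists (- acos x / (2 * pi)); rewrite /expi mulrC mulfVK // cosN sinN acosK //.
congr Complex; apply/eqP; move/eqP: y2; by rewrite eqf_sqr (negPf ny).
Qed.

End UnitCircle.

(** * Evaluation of specialised Laurent polynomials *)

Section Evaluation.
Variable K : unitRingType.
Implicit Types (h : laurent1 K) (a b : K) (g : laurent2).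

Lemma laurent1_eval_supp (d : {fset int}) h a : (msupp h `<=` d)%fset ->
  laurent1_eval h a = \sum_(m <- d) mcoeff m h * a ^ m.
Proof.
by move=> hd; apply: big_fset_incl => // m _ /mcoeff_outdom ->; rewrite mul0r.
Qed.

(** Distinct monomials of g may collapse onto the same power of y. Additivity of evaluation gives
    the formula without computing the collapsed coefficients. *)
Lemma laurent1_eval_specialize g a b :
  laurent1_eval (laurent_specialize g b) a =
  \sum_(k <- msupp g) (mcoeff k g)%:~R * b ^ k.2 * a ^ k.1.
Proof.
have evalD h1 h2 : laurent1_eval (h1 + h2) a = laurent1_eval h1 a + laurent1_eval h2 a.
  rewrite (laurent1_eval_supp _ (fsubsetUl (msupp h1) (msupp h2))).
  rewrite (laurent1_eval_supp _ (fsubsetUr (msupp h1) (msupp h2))).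
  rewrite (laurent1_eval_supp _ (msuppD_le h1 h2)) -big_split /=.
  by apply: eq_bigr => m _; rewrite mcoeffD mulrDl.
have eval0 : laurent1_eval (0 : laurent1 K) a = 0.
  by rewrite /laurent1_eval msupp0 big_seq_fset0.
rewrite (big_morph (fun h : laurent1 K => laurent1_eval h a) evalD eval0).
apply: eq_bigr => k _.
by rewrite (laurent1_eval_supp _ msuppU_le) big_seq_fset1 mcoeffUU.
Qed.

End Evaluation.

(** * The functions G_i on the circle: periodicity, bounds, continuity *)

Section Fibre.
Variable R : realType.
Implicit Types (g : laurent2) (alpha t : R).
Local Notation normc := (@Normc.normc R).
Local Notation Re := (@complex.Re R).
Local Notation Im := (@complex.Im R).

Definition fibre g alpha t : R[i] := laurent2_eval g (expi t) (expi alpha).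

Lemma fibreE g alpha t :
  fibre g alpha t = \sum_(k <- msupp g)
    (mcoeff k g)%:~R * expi (k.1%:~R * t + k.2%:~R * alpha).
Proof. by apply: eq_bigr => k _; rewrite expiD !expi_int. Qed.

Lemma fibre_specialize g alpha t :
  laurent1_eval (laurent_specialize g (expi alpha)) (expi t) = fibre g alpha t.
Proof.
rewrite laurent1_eval_specialize; apply: eq_bigr => k _.
set u := expi alpha ^ _; set v := expi t ^ _; move: u v => u v.
by rewrite -mulrA (mulrC u).
Qed.

Lemma fibre_periodic g alpha t (m : int) : fibre g alpha (t + m%:~R) = fibre g alpha t.
Proof. by rewrite /fibre expi_periodic. Qed.

Lemma ReD (z w : R[i]) : Re (z + w) = Re z + Re w.
Proof. by case: z; case: w. Qed.

Lemma ImD (z w : R[i]) : Im (z + w) = Im z + Im w.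
Proof. by case: z; case: w. Qed.

Lemma ReMz (m : int) (z : R[i]) : Re (m%:~R * z) = m%:~R * Re z.
Proof.
rewrite -(rmorph_int (real_complex R)); case: z => x y /=.
by rewrite mul0r subr0.
Qed.

Lemma ImMz (m : int) (z : R[i]) : Im (m%:~R * z) = m%:~R * Im z.
Proof.
rewrite -(rmorph_int (real_complex R)); case: z => x y /=.
by rewrite mul0r addr0.
Qed.

Lemma normc_sqrt (z : R[i]) : normc z = Num.sqrt (Re z ^+ 2 + Im z ^+ 2).
Proof. by case: z. Qed.

Lemma ler_Re_normc (z : R[i]) : `|Re z| <= normc z.
Proof.
rewrite normc_sqrt -sqrtr_sqr ler_sqrt ?addr_ge0 ?sqr_ge0 //.
by rewrite lerDl sqr_ge0.
Qed.

(** Triangle inequality; the added 1 ensures M >= 1, hence ln M >= 0. *)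
Lemma fibre_bounded g alpha : exists2 M : R, 1 <= M &
  forall t, normc (fibre g alpha t) <= M.
Proof.
exists (1 + \sum_(k <- msupp g) normc (mcoeff k g)%:~R).
  by rewrite lerDl sumr_ge0 // => k _; rewrite normc_sqrt sqrtr_ge0.
move=> t; rewrite fibreE.
apply: (@le_trans _ _ (\sum_(k <- msupp g) normc (mcoeff k g)%:~R)); last by rewrite lerDr.
elim/big_ind2: _ => [|z x w y zx wy|k _]; first by rewrite Normc.normc0.
- exact: le_trans (le_normcD _ _) (lerD zx wy).
- by rewrite Normc.normcM normc_expi mulr1.
Qed.

(** The real and imaginary parts are trigonometric polynomials in t. *)
Lemma continuous_fibre g alpha : continuous (fun t => normc (fibre g alpha t)).
Proof.
have arg (k : int * int) t :
    {for t, continuous (fun t => 2 * pi * (k.1%:~R * t + k.2%:~R * alpha) : R)}.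
  apply: cvgM; first exact: cvg_cst.
  by apply: cvgD; [apply: cvgM; [exact: cvg_cst|exact: cvg_id]|exact: cvg_cst].
have cRe : continuous (fun t => Re (fibre g alpha t)).
  have -> : (fun t => Re (fibre g alpha t)) = fun t => \sum_(k <- msupp g)
      (mcoeff k g)%:~R * cos (2 * pi * (k.1%:~R * t + k.2%:~R * alpha)).
    apply/funext => t; rewrite fibreE (big_morph _ ReD (erefl : Re 0 = 0)).
    by apply: eq_bigr => k _; rewrite ReMz.
  move=> t; apply: cvg_big => [|k _]; first exact: add_continuous.
  apply: cvgM; first exact: cvg_cst.
  exact: (continuous_comp (arg k t) (@continuous_cos R _)).
have cIm : continuous (fun t => Im (fibre g alpha t)).
  have -> : (fun t => Im (fibre g alpha t)) = fun t => \sum_(k <- msupp g)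
      (mcoeff k g)%:~R * sin (2 * pi * (k.1%:~R * t + k.2%:~R * alpha)).
    apply/funext => t; rewrite fibreE (big_morph _ ImD (erefl : Im 0 = 0)).
    by apply: eq_bigr => k _; rewrite ImMz.
  move=> t; apply: cvg_big => [|k _]; first exact: add_continuous.
  apply: cvgM; first exact: cvg_cst.
  exact: (continuous_comp (arg k t) (@continuous_sin R _)).
have -> : (fun t => normc (fibre g alpha t)) =
    fun t => Num.sqrt (Re (fibre g alpha t) ^+ 2 + Im (fibre g alpha t) ^+ 2).
  by apply/funext => t; exact: normc_sqrt.
move=> t; apply: continuous_cvg; first exact: sqrt_continuous.
apply: cvgD; apply: cvgM; [exact: cRe|exact: cRe|exact: cIm|exact: cIm].
Qed.

Lemma log_mahler_fibre g alpha :
  log_mahler (laurent_specialize g (expi alpha)) =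
  (\int[@lebesgue_measure R]_(t in `[0%R, 1%R]) lne (normc (fibre g alpha t))%:E)%E.
Proof. by apply: eq_integral => t _; rewrite -fibre_specialize. Qed.

End Fibre.

(** * Finitely supported approximate solutions of the recursion *)

Section Segment.
Variable R : realType.
Local Notation normc := (@Normc.normc R).
Notation I01 := (`[0%R, 1%R]%classic : set R).

Let normc_ge0 (z : R[i]) : 0 <= normc z.
Proof. by rewrite normc_sqrt sqrtr_ge0. Qed.

(** Products of the quotients G0/G1 solve the recursion exactly inside an orbit segment;
    [exists_small_product] provides a segment at whose two ends the solution can be cut off with
    error at most r. *)
Lemma finite_orbit_segment (G0 G1 : R -> R[i]) (M alpha t0 r : R) :
  continuous (fun t => normc (G0 t)) -> continuous (fun t => normc (G1 t)) ->
  1 <= M -> (forall t, normc (G0 t) <= M) -> (forall t, normc (G1 t) <= M) ->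
  (forall t (m : int), G0 (t + m%:~R) = G0 t) ->
  (forall t (m : int), G1 (t + m%:~R) = G1 t) ->
  G1 t0 = 0 -> irrational_rotation alpha -> 0 < r ->
  (\int[@lebesgue_measure R]_(t in I01) lne (normc (G0 t))%:E <
   \int[@lebesgue_measure R]_(t in I01) lne (normc (G1 t))%:E)%E ->
  exists (t : R) (c : int -> R[i]),
    [/\ c 0 = 1, forall k, normc (c k) <= 1 &
        forall k, normc (c (k + 1) * G1 (t + k%:~R * alpha)
                         - c k * G0 (t + k%:~R * alpha)) <= r].
Proof.
move=> c0 c1 M1 B0 B1 per0 per1 G1t0 irr r0 lt01.
have M0 : 0 < M by exact: lt_le_trans M1.
have d0 : 0 < r / M by exact: divr_gt0.
have [|||||t [n [tn pos prodlt]]] := @exists_small_product R (fun t => normc (G0 t))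
  (fun t => normc (G1 t)) M alpha t0 (r / M) c0 c1 M1 _ _ _ _ _ irr d0 lt01.
- by move=> x; rewrite normc_ge0 B0.
- by move=> x; rewrite normc_ge0 B1.
- by move=> x m; rewrite per0.
- by move=> x m; rewrite per1.
- by rewrite G1t0 Normc.normc0.
have rM : r / M <= r by rewrite ler_pdivrMr // ler_peMr // ltW.
have G1neq0 k : (k < n)%N -> G1 (t + k%:R * alpha) != 0.
  by move=> /pos; apply: contraTneq => ->; rewrite Normc.normc0 ltxx.
pose u k := \prod_(j < k) (G0 (t + j%:R * alpha) / G1 (t + j%:R * alpha)).
have normu k : normc (u k) =
    \prod_(j < k) (normc (G0 (t + j%:R * alpha)) / normc (G1 (t + j%:R * alpha))).
  rewrite (big_morph normc (@Normc.normcM R) (Normc.normc1 R)).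
  by apply: eq_bigr => j _; rewrite Normc.normcM Normc.normcV.
have un : normc (u n) < r / M.
  rewrite normu prodf_div ltr_pdivrMr //.
  by apply: prodr_gt0 => j _; exact: pos.
pose a (k : int) : R[i] := if k is Posz m then if (m <= n)%N then u m else 0 else 0.
(* Errors occur only at k = n, where |u_n| |G0| <= (r / M) M, and at k = -1, that is [Negz 0], where
   u_0 = 1 leaves |G1(t - alpha)| < r / M <= r. *)
have err k : normc (a (k + 1) * G1 (t + k%:~R * alpha)
                    - a k * G0 (t + k%:~R * alpha)) <= r.
  case: k => [k|[|k]].
  - rewrite -PoszD addn1 /= -[(Posz k)%:~R]/(k%:R).
    have [kn|nk|->] := ltngtP k n.
    + rewrite /u big_ord_recr /= -/(u k) mulrA mulfVK ?G1neq0 // subrr.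
      by rewrite Normc.normc0 ltW.
    + by rewrite !mul0r subr0 Normc.normc0 ltW.
    + rewrite mul0r sub0r normcN Normc.normcM.
      rewrite -[leRHS](@divfK _ M) ?gt_eqF //; apply: ler_pM => //.
      exact: ltW.
  - have -> : Negz 0 + 1 = 0 :> int by [].
    rewrite /= /u big_ord0 mul1r mul0r subr0.
    by rewrite (le_trans _ rM) // ltW //; congr (normc (G1 _) < _): tn; ring.
  - have -> : Negz k.+1 + 1 = Negz k :> int by lia.
    by rewrite /= !mul0r subr0 Normc.normc0 ltW.
(* The peak of |u_k| becomes the new origin and u_K is divided out: the value at 0 is then 1 and no
   other is larger. As |u_K| >= |u_0| = 1, the errors do not grow. *)
pose K := [arg max_(i > (ord0 : 'I_n.+1)) normc (u i)]%O.
have Kmax k : (k <= n)%N -> normc (u k) <= normc (u K).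
  rewrite /K; case: arg_maxP => //= i _ Hi kn.
  exact: (Hi (Ordinal (kn : (k < n.+1)%N))).
have uK1 : 1 <= normc (u K).
  by rewrite (le_trans _ (Kmax 0%N _)) // /u big_ord0 Normc.normc1.
have uK0 : 0 < normc (u K) by exact: lt_le_trans uK1.
have uKneq0 : u K != 0.
  by apply: contraTneq uK0 => ->; rewrite Normc.normc0 ltxx.
exists (t + K%:R * alpha), (fun k => a (k + K%:Z) / u K); split.
- by rewrite add0r /= -ltnS ltn_ord divff.
- move=> k; rewrite Normc.normcM Normc.normcV ler_pdivrMr // mul1r /a.
  case: (k + K%:Z) => [m|m]; last by rewrite Normc.normc0 ltW.
  by case: ifP => [/Kmax//|_]; rewrite Normc.normc0 ltW.
- move=> k.
  have -> : t + K%:R * alpha + k%:~R * alpha = t + (k + K%:Z)%:~R * alpha.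
    by rewrite rmorphD /= -pmulrn; ring.
  rewrite addrAC mulrAC [X in _ - X]mulrAC -mulrBl Normc.normcM Normc.normcV.
  rewrite ler_pdivrMr // (le_trans (err _)) // ler_peMr // ltW //.
Qed.

End Segment.

(** * From solutions of the recursion to functions on the Heisenberg group *)

Section ApproximateKernel.
Variable R : realType.
Local Notation normc := (@Normc.normc R).
Local Notation Re := (@complex.Re R).
Implicit Types (g : laurent2) (alpha theta : R).

(** On the normal subgroup generated by y and z the exponential is a character. The function is
    equivariant for it under left multiplication, and c weights the cosets, indexed by the exponent
    of x. *)
Definition twisted_character alpha theta (c : int -> R[i]) (b : heisenberg) : R[i] :=
  expi (alpha * (heis02 b)%:~R + theta * (heis12 b)%:~R) * c (heis01 b).

Lemma conv_laurent_yz (V : zmodType) g (w : heisenberg -> V) b :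
  conv (laurent_yz g) w b =
  \sum_(k <- msupp g) w (b * (expgz hy k.1 * expgz hz k.2))%g *~ mcoeff k g.
Proof. by rewrite conv_sum; apply: eq_bigr => k _; rewrite convU. Qed.

Lemma conv_laurent_yzM (V : zmodType) g a (w : heisenberg -> V) b :
  conv (laurent_yz g * gr_elt a) w b =
  \sum_(k <- msupp g) w (b * (expgz hy k.1 * expgz hz k.2) * a)%g *~ mcoeff k g.
Proof.
rewrite mulr_suml conv_sum; apply: eq_bigr => k _.
by rewrite [_ * _](gr_mulUU (mcoeff k g) 1) mulr1 convU mulgA.
Qed.

(** Here y stands for a monomial in [hy] and [hz], and z for [hx] or the identity: the two shapes of
    the terms of f. The mixed term of [heis02M] moves theta to its image under [heis01 b]
    rotations. *)
Lemma twisted_characterM alpha theta (c : int -> R[i]) b y z :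
  heis01 y = 0 -> heis12 z = 0 -> heis02 z = 0 ->
  twisted_character alpha theta c (b * y * z)%g =
  expi (alpha * (heis02 b)%:~R + theta * (heis12 b)%:~R) *
  (c (heis01 b + heis01 z) *
   expi ((heis12 y)%:~R * (theta + (heis01 b)%:~R * alpha) + (heis02 y)%:~R * alpha)).
Proof.
move=> y1 z2 z3; rewrite /twisted_character !(heis01M, heis12M, heis02M) y1 z2 z3.
rewrite !(mulr0, addr0) !rmorphD !rmorphM /= [c _ * _]mulrC mulrA -expiD.
by congr (expi _ * _); ring.
Qed.

Lemma conv_twisted_character g0 g1 alpha theta (c : int -> R[i]) b :
  conv (laurent_yz g1 * gr_elt hx - laurent_yz g0) (twisted_character alpha theta c) b =
  expi (alpha * (heis02 b)%:~R + theta * (heis12 b)%:~R) *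
    (c (heis01 b + 1) * fibre g1 alpha (theta + (heis01 b)%:~R * alpha)
     - c (heis01 b) * fibre g0 alpha (theta + (heis01 b)%:~R * alpha)).
Proof.
have [x1 x2 x3] := heis_coordx; have [u1 u2 u3] := heis_coord1.
rewrite convB conv_laurent_yz conv_laurent_yzM mulrBr !fibreE !mulr_sumr.
congr (_ - _); apply: eq_bigr => k _; have [k1 k2 k3] := heis_coord_yz k.
- by rewrite twisted_characterM // k2 k3 x1 -mulrzl mulrCA; congr (_ * _); rewrite mulrCA.
- rewrite -[X in twisted_character _ _ _ X]mulg1 twisted_characterM // k2 k3 u1 addr0.
  by rewrite -mulrzl mulrCA; congr (_ * _); rewrite mulrCA.
Qed.

(** The convolution is a phase of modulus 1 times the defect of the recursion at k = [heis01 b]. The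
    real part commutes with it, since f has integer coefficients, and does not increase moduli. *)
Lemma approximate_kernel_fibre g0 g1 alpha theta r (c : int -> R[i]) :
  c 0 = 1 -> (forall k, normc (c k) <= 1) ->
  (forall k, normc (c (k + 1) * fibre g1 alpha (theta + k%:~R * alpha)
                    - c k * fibre g0 alpha (theta + k%:~R * alpha)) <= r) ->
  exists w : heisenberg -> R, [/\ forall a, `|w a| <= 1, w 1%g = 1 &
    forall b, `|conv (laurent_yz g1 * gr_elt hx - laurent_yz g0) w b| <= r].
Proof.
move=> c0 c1 cr; have [u1 u2 u3] := heis_coord1.
have Re_zmod : zmod_morphism Re by case=> a b; case.
pose re : {additive R[i] -> R} :=
  HB.pack (Re : R[i] -> R) (GRing.isZmodMorphism.Build _ _ Re Re_zmod).
exists (re \o twisted_character alpha theta c); split=> [a||b].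
- rewrite (le_trans (ler_Re_normc _)) // /twisted_character Normc.normcM normc_expi.
  by rewrite mul1r.
- by rewrite /= /twisted_character u1 u2 u3 !mulr0 addr0 expi0 c0 mulr1.
- rewrite -raddf_conv conv_twisted_character (le_trans (ler_Re_normc _)) //.
  by rewrite Normc.normcM normc_expi mul1r.
Qed.

End ApproximateKernel.

(** * Assembly, according to which Mahler measure is larger *)

Theorem theorem7p6 (R : realType) (f : group_ring heisenberg)
    (g0 g1 : laurent2)
    (hf : f = laurent_yz g1 * gr_elt hx - laurent_yz g0)
    (hchi : exists chi : R[i],
        unit_circle chi /\
        (forall n : nat, (0 < n)%N -> chi ^+ n <> 1) /\
        U_ chi g0 <> set0 /\
        U_ chi g1 <> set0 /\
        log_mahler (laurent_specialize g0 chi) <>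
          log_mahler (laurent_specialize g1 chi))
    (d : principal_space R f -> principal_space R f -> R)
    (hd : invariant_metric d) :
  ~ expansive (@principal_action R heisenberg f) d.
Proof.
have [chi [/expi_surj[alpha ->] [chi_inf [U0 [U1 neq]]]]] := hchi.
suff [w [w1 w1E wf]] : exists w : heisenberg -> R,
    [/\ forall a, `|w a| <= 1, w 1%g = 1 & forall b, conv f w b = 0].
  exact: bounded_kernel_nonexpansive w1 w1E wf hd.
apply: approximate_kernel => r r0; rewrite hf.
have zero g : U_ (expi alpha) g <> set0 -> exists t, fibre g alpha t = 0.
  by move=> /eqP/set0P[zeta [/expi_surj[t ->] gt]]; exists t.
have [t0 G0t0] := zero _ U0; have [t1 G1t1] := zero _ U1.
have [M0 M01 B0] := fibre_bounded g0 alpha.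
have [M1 M11 B1] := fibre_bounded g1 alpha.
(* If q alpha were an integer, chi would have order dividing q. *)
have irr : irrational_rotation alpha.
  move=> q p q0; apply/eqP => qp; apply: (chi_inf q q0).
  by rewrite exprnP -expi_int -pmulrn qp -[p%:~R]add0r expi_periodic expi0.
have irrN : irrational_rotation (- alpha).
  move=> q p q0; rewrite mulrN eqr_oppLR -rmorphN /=; exact: irr.
pose M := M0 + M1.
have M_ge1 : 1 <= M by rewrite /M; lra.
have {}B0 t : Normc.normc (fibre g0 alpha t) <= M by apply: le_trans (B0 t) _; rewrite /M; lra.
have {}B1 t : Normc.normc (fibre g1 alpha t) <= M by apply: le_trans (B1 t) _; rewrite /M; lra.
have /eqP/lt_total/orP[lt01|lt10] :
    (\int[@lebesgue_measure R]_(t in `[0%R, 1%R]) lne (Normc.normc (fibre g0 alpha t))%:E)%E <>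
    (\int[@lebesgue_measure R]_(t in `[0%R, 1%R]) lne (Normc.normc (fibre g1 alpha t))%:E)%E.
  move=> E; apply: neq.
  exact: etrans (log_mahler_fibre g0 alpha) (etrans E (esym (log_mahler_fibre g1 alpha))).
- have [t [c [c0 c1 cr]]] := finite_orbit_segment (@continuous_fibre _ _ _)
    (@continuous_fibre _ _ _) M_ge1 B0 B1 (@fibre_periodic _ _ _)
    (@fibre_periodic _ _ _) G1t1 irr r0 lt01.
  exact: approximate_kernel_fibre c0 c1 cr.
- have [t [c [c0 c1 cr]]] := finite_orbit_segment (@continuous_fibre _ _ _)
    (@continuous_fibre _ _ _) M_ge1 B1 B0 (@fibre_periodic _ _ _)
    (@fibre_periodic _ _ _) G0t0 irrN r0 lt10.
  (* Time reversal: the segment is built with g0 and g1 exchanged and the rotation by -alpha. Its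
     recursion at index -k - 1 is evaluated at t + (k + 1) alpha, hence the base point t + alpha,
     and its defect is the opposite of the one required. *)
  apply: (@approximate_kernel_fibre _ g0 g1 alpha (t + alpha) r (fun k => c (- k))).
  + by rewrite oppr0.
  + by move=> k.
  + move=> k; have := cr (- k - 1).
    have -> : - k - 1 + 1 = - k by ring.
    have -> : t + (- k - 1)%:~R * - alpha = t + alpha + k%:~R * alpha.
      by rewrite rmorphB rmorphN /=; ring.
    have -> : - (k + 1) = - k - 1 by ring.
    by rewrite -opprB normcN.
Qed.
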